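(* Let $F$ be a field and let $L$ be a Lie algebra over $F$ whose dimension over $F$ is at most countable. Let $x \in L'$ be such that for each presentation $D$ of $x$, the corresponding weighted graph $\Gamma$ contains a defect of type $(m)_A$ (for some even $m\ge 4$), $(4)_B$ or $(4)_C$. Then $x \notin [L,L]$.
   Context: Lie algebra notation: $[L,L] := \{[x,y] : x,y\in L\}$ is the set of commutators (not its span); $L'$ is its $F$-linear span; $Z(L)$ is the center of $L$. Weighted graphs: a weighted graph over $F$ is a finite simple graph $\Gamma=(V,E)$ with ordered vertex set $V=\{v_1,\dots,v_n\}$, where each edge $e_{i,j}$ ($i<j$) joining $v_i$ and $v_j$ carries a weight $d_{i,j}\in F$ (possibly $0$). For an edge between $v_i$ and $v_j$ with $i<j$ put $d(v_i,v_j):=d_{i,j}$ and $d(v_j,v_i):=-d_{i,j}$. Defects of a weighted graph: - type $(m)_A$, where $m=2r-2$ with $r\ge3$: there are $m$ distinct vertices $w_1,\dots,w_r,x_1,\dots,x_{r-2}$ such that $w_jw_{j+1}$ ($1\le j\le r-1$), $w_rw_1$ and $w_jx_j$ ($1\le j\le r-2$) are edges; the weights of $w_jw_{j+1}$ ($1\le j\le r-2$) and of $w_rw_1$ are all $0$; and the weights of $w_{r-1}w_r$ and of $w_jx_j$ ($1\le j\le r-2$) are all nonzero. - type $(4)_B$: there are distinct vertices $p_1,p_2,p_3,p_4$ such that $p_1p_2,p_1p_3,p_1p_4,p_2p_3,p_3p_4$ are edges, $d(p_1,p_3)=0$, the weights $d(p_1,p_2),d(p_1,p_4),d(p_2,p_3),d(p_3,p_4)$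 are all nonzero, and $d(p_1,p_2)d(p_3,p_4)\neq -d(p_1,p_4)d(p_2,p_3)$. - type $(4)_C$: there are distinct vertices $p_1,p_2,p_3,p_4$, all six pairs of which are edges with nonzero weights, and $d(p_1,p_2)d(p_3,p_4)+d(p_1,p_4)d(p_2,p_3)\neq d(p_1,p_3)d(p_2,p_4)$. Other edges of $\Gamma$ may be present in addition to the listed ones. Presentations: let $\mathcal B_1$ be a basis of $Z(L)$, extended to a basis $\mathcal B_1\cup\mathcal B_2$ of $L$, with $\mathcal B_2=\{u_1,u_2,\dots\}$. Write $x=\sum_{1\le i<j\le r} d_{i,j}[u_i,u_j]$ with $d_{i,j}\in F$ (neither $\mathcal B_2$ nor the scalars are unique). Let $\mathcal I$ be the set of all indices $k$ such that $d_{k,j}\neq 0$ for some $j$ or $d_{i,k}\ne0$ for some $i$, and let $n=|\mathcal I|$. Permute the indices so that $\mathcal I=\{1,\dots,n\}$ (with the convention $d_{j,i}=-d_{i,j}$). The corresponding weighted graph $\Gamma$ has vertices $v_1,\dots,v_n$; $v_i$ and $v_j$ are adjacent if and only if $[u_i,u_j]\neq0$, and the edge $e_{i,j}$ ($i<j$) has weight $d_{i,j}$. The weight sequence $D=(d_{i,j})_{e_{i,j}\in E}$ so obtained (for any choice of $\mathcal B_2$, of scalars, and of permutation) is called a presentation of $x$, and $\Gamma$ is its corresponding weighted graph. *)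

(* Defs.v *)
From HB Require Import structures.
From mathcomp Require Import all_boot all_order all_algebra.
From mathcomp Require Import all_classical.

Set Implicit Arguments.
Unset Strict Implicit.
Unset Printing Implicit Defensive.

Import GRing.Theory.
Local Open Scope classical_set_scope.
Local Open Scope ring_scope.

HB.mixin Record Lmodule_isLieAlgebra (F : fieldType) L of GRing.Lmodule F L := {
  lie : L -> L -> L;
  lieDl : forall x y z, lie (x + y) z = lie x z + lie y z;
  lieDr : forall x y z, lie x (y + z) = lie x y + lie x z;
  lieZl : forall (a : F) x y, lie (a *: x) y = a *: lie x y;
  lieZr : forall (a : F) x y, lie x (a *: y) = a *: lie x y;
  liexx : forall x, lie x x = 0;
  lie_jacobi : forall x y z,
    lie x (lie y z) + lie y (lie z x) + lie z (lie x y) = 0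
}.

#[short(type="lieAlgType")]
HB.structure Definition LieAlgebra (F : fieldType) :=
  {L of Lmodule_isLieAlgebra F L & GRing.Lmodule F L}.

Section LinearAlgebra.
Variables (F : fieldType) (V : lmodType F).
Implicit Types A B W : set V.

Definition lin_span A : set V :=
  [set v | exists (n : nat) (c : 'I_n -> F) (a : 'I_n -> V),
    (forall i, A (a i)) /\ v = \sum_(i < n) c i *: a i].

Definition lin_indep A : Prop :=
  forall (n : nat) (c : 'I_n -> F) (a : 'I_n -> V),
    injective a -> (forall i, A (a i)) ->
    \sum_(i < n) c i *: a i = 0 -> forall i, c i = 0.

Definition is_basis B W : Prop := lin_indep B /\ lin_span B = W.

Definition countable_dim : Prop :=
  exists B : set V, is_basis B setT /\ countable B.

End LinearAlgebra.

Section LieAlgebraSets.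
Variables (F : fieldType) (L : lieAlgType F).

Definition commutators : set L := [set z | exists x y : L, z = lie x y].

Definition derived : set L := lin_span commutators.

Definition center : set L := [set x | forall y : L, lie x y = 0].

End LieAlgebraSets.

Arguments commutators {F} L.
Arguments derived {F} L.
Arguments center {F} L.

(* Only the values [wg_weight i j] with [i < j] and [wg_adj i j] are meaningful:
   they are the weights of the edges, for the natural order on ['I_n]. *)
Record wgraph (F : fieldType) := WGraph {
  wg_size : nat;
  wg_adj : rel 'I_wg_size;
  wg_sym : symmetric wg_adj;
  wg_irr : irreflexive wg_adj;
  wg_weight : 'I_wg_size -> 'I_wg_size -> F
}.

(* The signed weight $d(v_i,v_j)$. *)
Definition wg_d (F : fieldType) (G : wgraph F) (i j : 'I_(wg_size G)) : F :=
  if (i < j)%N then wg_weight i j else - wg_weight j i.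

Section Defects.
Variables (F : fieldType) (G : wgraph F).
Local Notation V := 'I_(wg_size G).
Local Notation adj := (@wg_adj F G).
Local Notation d := (@wg_d F G).

(* Only [w 1, ..., w r] and [x 1, ..., x (r - 2)] are used. *)
Definition defectA (m : nat) : Prop :=
  exists (r : nat) (w x : nat -> V),
    (3 <= r)%N /\ m = (2 * r - 2)%N /\
    uniq ([seq w j | j <- iota 1 r] ++ [seq x j | j <- iota 1 (r - 2)]) /\
    (forall j, (1 <= j <= r - 1)%N -> adj (w j) (w j.+1)) /\
    adj (w r) (w 1%N) /\
    (forall j, (1 <= j <= r - 2)%N -> adj (w j) (x j)) /\
    (forall j, (1 <= j <= r - 2)%N -> d (w j) (w j.+1) = 0) /\
    d (w r) (w 1%N) = 0 /\
    d (w (r - 1)%N) (w r) <> 0 /\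
    (forall j, (1 <= j <= r - 2)%N -> d (w j) (x j) <> 0).

Definition defectB : Prop :=
  exists p1 p2 p3 p4 : V,
    uniq [:: p1; p2; p3; p4] /\
    [/\ adj p1 p2, adj p1 p3, adj p1 p4, adj p2 p3 & adj p3 p4] /\
    d p1 p3 = 0 /\
    [/\ d p1 p2 <> 0, d p1 p4 <> 0, d p2 p3 <> 0 & d p3 p4 <> 0] /\
    d p1 p2 * d p3 p4 <> - (d p1 p4 * d p2 p3).

Definition defectC : Prop :=
  exists p1 p2 p3 p4 : V,
    uniq [:: p1; p2; p3; p4] /\
    [/\ adj p1 p2, adj p1 p3 & adj p1 p4] /\
    [/\ adj p2 p3, adj p2 p4 & adj p3 p4] /\
    [/\ d p1 p2 <> 0, d p1 p3 <> 0 & d p1 p4 <> 0] /\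
    [/\ d p2 p3 <> 0, d p2 p4 <> 0 & d p3 p4 <> 0] /\
    d p1 p2 * d p3 p4 + d p1 p4 * d p2 p3 <> d p1 p3 * d p2 p4.

Definition has_defect : Prop :=
  (exists m : nat, ~~ odd m /\ (4 <= m)%N /\ defectA m) \/ defectB \/ defectC.

End Defects.

Section Coefficients.
Variables (F : fieldType) (r : nat) (d : 'M[F]_r).

(* Only the entries of [d] strictly above the diagonal are used; [skew_coef]
   extends them by the convention $d_{j,i} = -d_{i,j}$. *)
Definition skew_coef (i j : 'I_r) : F :=
  if (i < j)%N then d i j else if (j < i)%N then - d j i else 0.

Definition coef_support : {set 'I_r} :=
  finset (fun k : 'I_r =>
    [exists j : 'I_r, (k < j)%N && (d k j != 0)] ||
    [exists i : 'I_r, (i < k)%N && (d i k != 0)]).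

End Coefficients.

(* [pr_u], restricted to the initial segment [pr_dom] of [nat] (which is finite
   or all of [nat]), enumerates [pr_B2] without repetition, starting from index
   0.  The renumbering of the support of the coefficients is [pr_perm]. *)
Record presentation (F : fieldType) (L : lieAlgType F) (x : L) := Presentation {
  pr_B1 : set L;
  pr_B2 : set L;
  pr_basis1 : is_basis pr_B1 (center L);
  pr_disj : pr_B1 `&` pr_B2 = set0;
  pr_basis : is_basis (pr_B1 `|` pr_B2) setT;
  pr_dom : set nat;
  pr_domP : forall i j : nat, (i <= j)%N -> pr_dom j -> pr_dom i;
  pr_u : nat -> L;
  pr_uP : set_bij pr_dom pr_B2 pr_u;
  pr_r : nat;
  pr_rP : forall i : 'I_pr_r, pr_dom i;
  pr_coef : 'M[F]_pr_r;
  pr_sum : x = \sum_(i < pr_r) \sum_(j < pr_r | (i < j)%N)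
                 pr_coef i j *: lie (pr_u i) (pr_u j);
  pr_perm : 'I_#|coef_support pr_coef| -> 'I_pr_r;
  pr_perm_inj : injective pr_perm;
  pr_permP : forall i, pr_perm i \in coef_support pr_coef
}.

Section PresentationGraph.
Variables (F : fieldType) (L : lieAlgType F) (x : L) (D : presentation x).
Local Notation n := #|coef_support (pr_coef D)|.

Definition pr_vec (i : 'I_n) : L := pr_u D (pr_perm i).

Definition pr_adj : rel 'I_n := fun i j => lie (pr_vec i) (pr_vec j) != 0.

Lemma pr_adj_sym : symmetric pr_adj.
Proof.
move=> i j; rewrite /pr_adj; move: (pr_vec i) (pr_vec j) => a b.
have := liexx (a + b).
rewrite lieDl !lieDr !liexx add0r addr0 => /eqP.
by rewrite addr_eq0 => /eqP ->; rewrite oppr_eq0.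
Qed.

Lemma pr_adj_irr : irreflexive pr_adj.
Proof. by move=> i; rewrite /pr_adj liexx eqxx. Qed.

Definition pr_graph : wgraph F :=
  WGraph pr_adj_sym pr_adj_irr
    (fun i j => skew_coef (pr_coef D) (pr_perm i) (pr_perm j)).

End PresentationGraph.

(* Main.v *)
(* If x = [a, b] is nonzero, then a and b are linearly independent modulo the
   center, so they can be taken among the u_i. The presentation x = [a, b] then
   has a graph on two vertices, while every defect needs at least four. *)
Require Import Defs.
From mathcomp Require Import all_boot all_order all_algebra.
From mathcomp Require Import all_classical.

Set Implicit Arguments.
Unset Strict Implicit.
Unset Printing Implicit Defensive.

Import GRing.Theory.
Local Open Scope classical_set_scope.
Local Open Scope ring_scope.

(** * Linear spans, independent sets and extension by Zorn's lemma *)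

Section LinearAlgebra.
Variables (F : fieldType) (V : lmodType F).
Implicit Types (A B S : set V) (u v : V).

Lemma sub_lin_span A : A `<=` lin_span A.
Proof.
move=> v Av; exists 1%N, (fun=> 1), (fun=> v); split=> //.
by rewrite big_ord1 scale1r.
Qed.

Lemma lin_spanZ A (k : F) v : lin_span A v -> lin_span A (k *: v).
Proof.
move=> [n [c [a [Aa ->]]]]; exists n, (fun i => k * c i), a; split=> //.
by rewrite scaler_sumr; apply: eq_bigr => i _; rewrite scalerA.
Qed.

Lemma lin_spanD A u v : lin_span A u -> lin_span A v -> lin_span A (u + v).
Proof.
move=> [n [c [a [Aa ->]]]] [m [d [b [Ab ->]]]].
(* Concatenation of two families, used for both coefficients and vectors. *)
pose glue (T : Type) (f : 'I_n -> T) (g : 'I_m -> T) (i : 'I_(n + m)) :=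
  match fintype.split i with inl j => f j | inr j => g j end.
exists (n + m)%N, (glue _ c d), (glue _ a b); split.
  by move=> i; rewrite /glue; case: (fintype.split i).
rewrite big_split_ord /=; congr (_ + _); apply: eq_bigr => i _; rewrite /glue.
  by rewrite -/(unsplit (inl i)) unsplitK.
by rewrite -/(unsplit (inr i)) unsplitK.
Qed.

Lemma lin_span_min A (W : set V) : W 0 ->
  (forall u v, W u -> W v -> W (u + v)) -> (forall k v, W v -> W (k *: v)) ->
  A `<=` W -> lin_span A `<=` W.
Proof.
move=> W0 WD WZ AW v [n [c [a [Aa ->]]]].
by apply: (big_ind W) => // i _; apply/WZ/AW.
Qed.

Lemma lin_span0 A : lin_span A 0.
Proof.
by exists 0%N, (fun=> 0), (fun=> 0); split; [case | rewrite big_ord0].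
Qed.

Lemma lin_span_sub A B : A `<=` lin_span B -> lin_span A `<=` lin_span B.
Proof.
apply: lin_span_min; [exact: lin_span0 | exact: lin_spanD|].
by move=> k v; exact: lin_spanZ.
Qed.

Lemma lin_indep0 : @lin_indep F V set0.
Proof. by move=> n c a _ a0 _ i; case: (a0 i). Qed.

(** A relation with a nonzero coefficient at [v] could be solved for [v] in terms of [A]; with a
    zero coefficient it is a relation within [A]. *)
Lemma lin_indep_set1U A v : lin_indep A -> ~ lin_span A v ->
  lin_indep (A `|` [set v]).
Proof.
move=> iA nAv n c a inja aAv s0.
(* By injectivity [v] occurs at most once in the family; if it is absent, the family lies in [A]. *)
have [[i0 ai0]|nv] := pselect (exists i, a i = v); last first.
  apply: (iA n c a) => // i; case: (aAv i) => // aiv.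
  by case: nv; exists i.
case: n c a inja aAv s0 i0 ai0 => [|n] c a inja aAv s0 i0 ai0; first by case: i0 ai0.
have Al i : A (a (lift i0 i)).
  case: (aAv (lift i0 i)) => // aiv; have /inja/eqP : a (lift i0 i) = a i0.
    by rewrite ai0.
  by rewrite eq_sym (negPf (neq_lift _ _)).
move: s0; rewrite (bigD1_ord i0) //= ai0 => s0.
have [c0|c0] := eqVneq (c i0) 0.
  move: s0; rewrite c0 scale0r add0r => /(iA n _ _ _ Al) cl i.
  case: (unliftP i0 i) => [j|] -> //; apply: cl => j1 j2 /inja.
  exact: lift_inj.
case: nAv; have -> : v = \sum_(i < n) (- (c i0)^-1 * c (lift i0 i)) *: a (lift i0 i).
  rewrite -[LHS]scale1r -(mulVf c0) -scalerA.
  move/eqP: s0; rewrite addr_eq0 => /eqP ->.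
  rewrite scalerN -scaleNr scaler_sumr.
  by apply: eq_bigr => i _; rewrite scalerA.
by exists n, (fun i => - (c i0)^-1 * c (lift i0 i)), (fun i => a (lift i0 i)).
Qed.

(** A relation involves finitely many vectors, so in a chain a single member [X], together with [A],
    contains them all. The independence of [A] itself covers the empty chain. *)
Lemma lin_indep_bigcup A (C : set (set V)) : lin_indep A ->
  total_on C subset -> (forall X, C X -> lin_indep (A `|` X)) ->
  lin_indep (A `|` \bigcup_(X in C) X).
Proof.
move=> iA totC iC n c a inja aAC.
suff [Aa|[X [CX AXa]]] : (forall i, A (a i)) \/
    exists X, C X /\ forall i, (A `|` X) (a i).
- exact: iA.
- exact: (iC X).
elim: n {c inja} a aAC => [|n IHn] a aAC; first by left; case.
have [Aa|[X [CX AXa]]] := IHn (fun i => a (lift ord0 i)) (fun i => aAC _).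
  case: (aAC ord0) => [A0|[X CX X0]]; [left|right; exists X; split=> //];
    move=> i; case: (unliftP ord0 i) => [j|] -> //; first by left.
  by right.
right; case: (aAC ord0) => [A0|[Y CY Y0]].
  by exists X; split=> // i; case: (unliftP ord0 i) => [j|] -> //; left.
(* The larger of [X] (for the tail) and [Y] (for the head) serves the whole family. *)
have [XY|YX] := totC _ _ CX CY; [exists Y|exists X]; split=> // i;
  case: (unliftP ord0 i) => [j|] -> //; last 1 first.
- by right; exact: YX.
- by case: (AXa j); [left|right; exact: XY].
- by right.
Qed.

(** Take [X] maximal among the subsets of [S] with [A] and [X] jointly independent: an element of
    [S] outside the span could still be adjoined. Drawing the new vectors from [S] is what later
    gives control of cardinality. *)
Lemma lin_indep_extend A S : lin_indep A ->
  exists B, [/\ A `<=` B, B `<=` A `|` S, lin_indep B & S `<=` lin_span B].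
Proof.
move=> iA.
have [C CP totC|X [[XS iX] maxX]] :=
    @Zorn_bigcup V (fun X => X `<=` S /\ lin_indep (A `|` X)).
  split; first by apply: bigcup_sub => X /CP[].
  by apply: lin_indep_bigcup => // X /CP[].
exists (A `|` X); split=> //.
  by move=> v [Av|/XS Sv]; [left|right].
move=> s Ss; apply: contrapT => ns.
apply: (maxX (X `|` [set s])).
  split; first by move=> v; left.
  by move=> sX; apply/ns/sub_lin_span; right; apply: sX; right.
split; first by move=> v [/XS|->].
by rewrite setUA; exact: lin_indep_set1U.
Qed.

End LinearAlgebra.

(** Supplies the indexing that a presentation requires: [D] is [I_n] if [A] is finite and all of
    [nat] otherwise. The element [t] excludes an empty [T], to which [nat] has no map. *)
Lemma countable_enumeration (T : Type) (t : T) (A : set T) : countable A ->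
  exists (D : set nat) (u : nat -> T),
    (forall i j, (i <= j)%N -> D j -> D i) /\ set_bij D A u.
Proof.
elim/Ppointed: T => T in t A *; first by case: (no t).
move=> cA; have [[n /card_esym/card_set_bijP[u bu]]|iA] := pselect (finite_set A).
  by exists `I_n, u; split=> // i j; exact: leq_ltn_trans.
have /card_esym/card_set_bijP[u bu] := eq_card_nat cA iA.
by exists setT, u.
Qed.

(** * Brackets, the center, and bases of the algebra adapted to it *)

Section LieAlgebra.
Variables (F : fieldType) (L : lieAlgType F).
Implicit Types a b x : L.

Lemma lie0r a : lie a 0 = 0.
Proof. by rewrite -[X in lie a X](scale0r 0) lieZr scale0r. Qed.

Lemma lieC a b : lie a b = - lie b a.
Proof.
have := liexx (a + b); rewrite lieDl !lieDr !liexx add0r addr0 => /eqP.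
by rewrite addr_eq0 => /eqP.
Qed.

Lemma lin_span_lie0 a (A : set L) : (forall b, A b -> lie a b = 0) ->
  forall b, lin_span A b -> lie a b = 0.
Proof.
move=> A0 b; move: b; apply: lin_span_min => //=; first exact: lie0r.
  by move=> u v u0 v0; rewrite lieDr u0 v0 addr0.
by move=> k v v0; rewrite lieZr v0 scaler0.
Qed.

Lemma lie_center a b : center L b -> lie a b = 0.
Proof. by move=> Zb; rewrite lieC Zb oppr0. Qed.

(** The kernel of [lie a] is a subspace containing the center and [a] but not [b]; and [a] is not
    central. *)
Lemma lin_indep_center2 a b (B1 : set L) : is_basis B1 (center L) ->
  lie a b <> 0 -> lin_indep (B1 `|` [set a; b]).
Proof.
move=> [iB1 sB1] ab0; rewrite setUA; apply: lin_indep_set1U.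
  by apply: lin_indep_set1U => //; rewrite sB1 => Za; exact: ab0.
move=> sb; apply: ab0; apply: lin_span_lie0 sb => v [Bv|->]; last exact: liexx.
by apply: lie_center; rewrite -sB1; exact: sub_lin_span.
Qed.

(** [B1] is chosen inside the proof, so the independence of [A] is asked relative to every basis of
    the center. All further vectors come from a countable basis [E], which keeps [B2] countable. *)
Lemma center_basis_extend (A : set L) : countable_dim L -> countable A ->
  A `&` center L = set0 ->
  (forall B1, is_basis B1 (center L) -> lin_indep (B1 `|` A)) ->
  exists B1 B2 : set L, [/\ is_basis B1 (center L), B1 `&` B2 = set0,
    is_basis (B1 `|` B2) setT, countable B2 & A `<=` B2].
Proof.
move=> [E [[_ sE] cE]] cA AZ0 iA.
have [B1 [_ B1Z iB1 ZB1]] := lin_indep_extend (center L) (@lin_indep0 F L).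
have bB1 : is_basis B1 (center L).
  split=> //; apply/seteqP; split=> //; apply: lin_span_min.
  - by move=> y; rewrite lieC lie0r oppr0.
  - by move=> u v Zu Zv y; rewrite lieDl Zu Zv addr0.
  - by move=> k v Zv y; rewrite lieZl Zv scaler0.
  - by move=> v /B1Z[].
have [B [AB BE iB EB]] := lin_indep_extend E (iA _ bB1).
have B1B : B1 `<=` B by move=> v ?; apply: AB; left.
exists B1, (B `\` B1); split=> //.
- by rewrite setDE setICA setICr setI0.
- rewrite setDUK //; split=> //.
  apply/seteqP; split=> // v _; apply: (lin_span_sub EB).
  by rewrite sE.
- apply: (@sub_countable _ _ _ (\bigcup_(i in [set: bool]) if i then A else E)).
    apply: subset_card_le => v [/BE[[//|Av]|Ev] _]; first by exists true.
    by exists false.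
  by apply: bigcup_countable => [|[]].
(* [A] misses the center, so removing [B1] loses none of its elements. *)
- move=> v Av; split; first by apply: AB; right.
  move=> /B1Z[//|Zv]; have : (A `&` center L) v by [].
  by rewrite AZ0.
Qed.

End LieAlgebra.

(** * Sizes of defects, and presentations with at most two vertices *)

Lemma has_defect_size (F : fieldType) (G : wgraph F) :
  has_defect G -> (4 <= wg_size G)%N.
Proof.
have uniq_size (s : seq 'I_(wg_size G)) : uniq s -> (size s <= wg_size G)%N.
  by move=> us; rewrite -(card_uniqP us) (leq_trans (max_card _)) ?card_ord.
move=> [[m [_ [_ [r [w [x [r3 [_ [/uniq_size + _]]]]]]]]]|].
  rewrite size_cat !size_map !size_iota; apply: leq_trans.
  (* The count [r + (r - 2)] is smallest at [r = 3]. *)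
  by rewrite -[4%N]/(3 + (3 - 2))%N leq_add // leq_sub2r.
by case=> [[p1 [p2 [p3 [p4 [/uniq_size]]]]]|[p1 [p2 [p3 [p4 [/uniq_size]]]]]].
Qed.

(** Any numbering of the support is allowed, so the standard enumeration [enum_val] completes the
    data. *)
Lemma exists_presentation (F : fieldType) (L : lieAlgType F) (x : L)
    (B1 B2 : set L) (D : set nat) (u : nat -> L) (r : nat) (d : 'M[F]_r) :
  is_basis B1 (center L) -> B1 `&` B2 = set0 -> is_basis (B1 `|` B2) setT ->
  (forall i j, (i <= j)%N -> D j -> D i) -> set_bij D B2 u ->
  (forall i : 'I_r, D i) ->
  x = \sum_(i < r) \sum_(j < r | (i < j)%N) d i j *: lie (u i) (u j) ->
  exists P : presentation x, wg_size (pr_graph P) = #|coef_support d|.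
Proof.
move=> h1 h2 h3 h4 h5 h6 h7.
unshelve eexists (Presentation h1 h2 h3 h4 h5 h6 h7 _ _).
- exact: enum_val.
- exact: enum_val_inj.
- exact: enum_valP.
- by [].
Qed.

Lemma card_coef_support_delta (F : fieldType) (r : nat) (c : F) (p q : 'I_r) :
  (#|coef_support (c *: delta_mx p q)| <= 2)%N.
Proof.
apply: leq_trans (_ : #|[set p; q]%SET| <= 2)%N; last first.
  by rewrite cards2; case: (_ != _).
apply/subset_leq_card/fintype.subsetP => k; rewrite !inE.
case/orP => /existsP[j /andP[_]]; rewrite !mxE.
  by case: (k == p) => //; rewrite mulr0 eqxx.
by case: (k == q); rewrite ?orbT // andbF mulr0 eqxx.
Qed.

Lemma sum_delta_mx_lie (F : fieldType) (L : lieAlgType F) (u : nat -> L)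
    (r : nat) (c : F) (p q : 'I_r) : (p < q)%N ->
  \sum_(i < r) \sum_(j < r | (i < j)%N)
    (c *: delta_mx p q) i j *: lie (u i) (u j) = c *: lie (u p) (u q).
Proof.
move=> pq; rewrite (bigD1 p) //= (bigD1 q) //= !mxE !eqxx mulr1.
rewrite big1 ?addr0; last first.
  by move=> j /andP[_ /negPf jq]; rewrite !mxE jq andbF mulr0 scale0r.
rewrite big1 ?addr0 // => i /negPf ip; rewrite big1 // => j _.
by rewrite !mxE ip mulr0 scale0r.
Qed.

Lemma commutator_presentation (F : fieldType) (L : lieAlgType F) (x : L) :
  countable_dim L -> commutators L x ->
  exists P : presentation x, (wg_size (pr_graph P) <= 2)%N.
Proof.
move=> hL [a [b xab]]; have [x0|x0] := pselect (x = 0).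
  (* For [x = 0] no vector is prescribed and the empty sum, with a 0 by 0 matrix, is a
     presentation. *)
  have [|||B1 [B2 [h1 h2 h3 cB2 _]]] := @center_basis_extend F L set0 hL => //.
  - by rewrite set0I.
  - by move=> B1 [iB1 _]; rewrite setU0.
  have [D [u [hD hu]]] := countable_enumeration 0 cB2.
  have [||P Psize] := @exists_presentation F L x _ _ _ _ 0 0 h1 h2 h3 hD hu.
  - by case.
  - by rewrite big_ord0.
  - by exists P; rewrite Psize (leq_trans (max_card _)) // card_ord.
have ab0 : lie a b <> 0 by rewrite -xab.
have [|||B1 [B2 [h1 h2 h3 cB2 abB2]]] :=
    @center_basis_extend F L [set a; b] hL.
- by apply: finite_set_countable; exact: finite_set2.
- apply/seteqP; split=> // v [[->|->] Zv]; first exact: ab0.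
  exact/ab0/lie_center.
- by move=> B1 bB1; exact: lin_indep_center2.
have [D [u [hD hu]]] := countable_enumeration 0 cB2.
have [_ _ su] := hu.
have [i Di ui] : exists2 i, D i & u i = a by apply/su/abB2; left.
have [j Dj uj] : exists2 j, D j & u j = b by apply/su/abB2; right.
(* The enumeration may list [b] before [a]; the scalar [c], equal to 1 or -1, absorbs the swap. *)
suff [p [q [c [pq Dq xE]]]] : exists p q c,
    [/\ (p < q)%N, D q & x = c *: lie (u p) (u q)].
  (* Size [q.+1] is the least that contains both indices, and all indices up to [q] lie in the
     initial segment [D]. *)
  have pr : (p < q.+1)%N by rewrite ltnS ltnW.
  have [||P Psize] := @exists_presentation F L x _ _ _ _ q.+1
    (c *: delta_mx (Ordinal pr) ord_max) h1 h2 h3 hD hu.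
  - by move=> k; apply: hD Dq; rewrite -ltnS.
  - by rewrite sum_delta_mx_lie.
  - by exists P; rewrite Psize card_coef_support_delta.
have [ij|ji|ij] := ltngtP i j.
- by exists i, j, 1; rewrite scale1r ui uj.
- by exists j, i, (-1); rewrite scaleN1r ui uj -lieC.
- by case: ab0; rewrite -ui -uj ij liexx.
Qed.

Theorem theorem1p3 (F : fieldType) (L : lieAlgType F) (hL : countable_dim L)
    (x : L) (hx : derived L x)
    (hdef : forall D : presentation x, has_defect (pr_graph D)) :
  ~ commutators L x.
Proof.
move=> /(commutator_presentation hL)[P P2].
by have := leq_trans (has_defect_size (hdef P)) P2.
Qed.
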